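(* Let $n\geq 1$ and let $A, B, C\in \mathbb{C}^{n\times n}$ be positive definite matrices. Set $$M=A(B+C)^{-1} +B(C+A)^{-1} + C(A+B)^{-1}.$$ Then every eigenvalue $\lambda$ of $M$ is real and satisfies $\lambda \geq \frac{3}{2}$.
   Context: A matrix $A\in\mathbb{C}^{n\times n}$ is called positive definite if it is Hermitian and $x^*Ax>0$ for all $0\neq x\in\mathbb{C}^n$. The inequality ''$\lambda(M)\geq c$'' in the paper means that an arbitrary eigenvalue of $M$ is (real and) at least $c$. *)

(* Defs.v *)
From mathcomp Require Import all_boot all_order all_algebra.
From mathcomp Require Import sesquilinear spectral.
From mathcomp Require Import reals.
From mathcomp Require Import complex.

Set Implicit Arguments.
Unset Strict Implicit.
Unset Printing Implicit Defensive.

Import Order.TTheory GRing.Theory Num.Theory.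
Local Open Scope ring_scope.
Local Open Scope sesquilinear_scope.
Local Open Scope complex_scope.

(* [0 < z] in the order of [R[i]] means that [z] is real and positive. *)
Definition posdefmx (R : realType) (n : nat) (A : 'M[R[i]]_n) : Prop :=
  A \is hermsymmx /\
  forall x : 'cV[R[i]]_n, x != 0 -> 0 < (x ^t* *m A *m x) 0 0.

(* Main.v *)
Require Import Defs.
From mathcomp Require Import all_boot all_order all_algebra.
From mathcomp Require Import reals complex.
From mathcomp Require Import sesquilinear spectral ring.

Import Order.TTheory GRing.Theory Num.Theory.
Local Open Scope ring_scope.
Local Open Scope complex_scope.
Local Open Scope sesquilinear_scope.

(* With [S = A + B + C] and [X], [Y], [Z] the three denominators, [X + Y + Z = 2 S]
   and [M = S (X^-1 + Y^-1 + Z^-1) - 3].  For a left eigenvector [v] of [M] put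
   [u = v S].  Positivity of the form of [X] at [u X^-1 - (3/2) v] is a tangent
   bound for [u X^-1 u^*]; the sum of the three bounds is the AM-HM inequality
   [u (X^-1 + Y^-1 + Z^-1) u^* >= (9/2) v S v^*], whose left side is
   [(lambda + 3) v S v^*]. *)

Section PositiveDefinite.
Variables (R : realType) (n : nat).
Implicit Types (A B : 'M[R[i]]_n) (u v : 'rV[R[i]]_n).

Lemma posdefmx_herm A : posdefmx A -> A ^t* = A.
Proof. by case=> /is_hermitianmxP; rewrite expr0 scale1r => <-. Qed.

Lemma posdefmxD A B : posdefmx A -> posdefmx B -> posdefmx (A + B).
Proof.
move=> pA pB; split.
  apply/is_hermitianmxP; rewrite expr0 scale1r linearD map_mxD.
  by rewrite !posdefmx_herm.
move=> x x0; rewrite mulmxDr mulmxDl mxE.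
by apply: addr_gt0; [apply: pA.2 | apply: pB.2].
Qed.

(** Row version of the definition, taken at the column [v ^t*]: [eigenvalue] supplies row
    eigenvectors. *)
Lemma posdefmx_row_gt0 A v : posdefmx A -> v != 0 -> 0 < (v *m A *m v ^t*) 0 0.
Proof.
move=> pA v0; rewrite -{1}[v]trmxCK; apply: pA.2.
by apply: contraNneq v0 => v0; rewrite -[v]trmxCK v0 trmx0 map_mx0.
Qed.

Lemma posdefmx_row_ge0 A v : posdefmx A -> 0 <= (v *m A *m v ^t*) 0 0.
Proof.
move=> pA; have [->|v0] := eqVneq v 0; first by rewrite !mul0mx mxE.
exact/ltW/posdefmx_row_gt0.
Qed.

Lemma posdefmx_unit A : posdefmx A -> A \in unitmx.
Proof.
move=> pA; rewrite -row_free_unit; apply: inj_row_free => v vA0.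
apply/eqP/negPn/negP => /(posdefmx_row_gt0 _ _ pA).
by rewrite vA0 mul0mx mxE ltxx.
Qed.

(* Positivity of the form of [X] at [v (S X^-1 - t)]. *)
Lemma posdefmx_inv_tangent (X S : 'M[R[i]]_n) (t : R[i]) v :
  posdefmx X -> S ^t* = S -> t \is Num.real ->
  t *+ 2 * (v *m S *m v ^t*) 0 0 - t ^+ 2 * (v *m X *m v ^t*) 0 0
    <= (v *m (S *m invmx X *m S) *m v ^t*) 0 0.
Proof.
move=> pX hS ht; have uX := posdefmx_unit _ pX.
have := posdefmx_row_ge0 _ (v *m (S *m invmx X - t%:M)) pX.
have -> : (v *m (S *m invmx X - t%:M)) ^t* = (invmx X *m S - t%:M) *m v ^t*.
  rewrite trmx_mul map_mxM /= linearB /= map_mxB trmx_mul map_mxM /= hS.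
  rewrite trmx_inv map_invmx posdefmx_herm //.
  by rewrite tr_scalar_mx map_scalar_mx /= conj_Creal.
(* In both cross terms [X] cancels against its inverse, leaving [t] times the form of [S] each
   time. *)
have -> : v *m (S *m invmx X - t%:M) *m X *m ((invmx X *m S - t%:M) *m v ^t*) =
    v *m (S *m invmx X *m S) *m v ^t* - (t *+ 2) *: (v *m S *m v ^t*)
    + t ^+ 2 *: (v *m X *m v ^t*).
  rewrite !(mulmxBl, mulmxBr, mul_scalar_mx, mul_mx_scalar, mulmxA).
  rewrite !(mulmxKV uX, mulmxK uX) -!(scalemxAl, scalemxAr).
  by rewrite scalerA -expr2 mulr2n scalerDl !opprD opprK !addrA.
rewrite !mxE => form_ge0; rewrite -subr_ge0.
by rewrite opprB addrCA addrC.
Qed.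

End PositiveDefinite.

Theorem theorem2p5 (R : realType) (n : nat) (n_ge1 : (1 <= n)%N)
    (A B C : 'M[R[i]]_n)
    (A_posdef : posdefmx A) (B_posdef : posdefmx B) (C_posdef : posdefmx C)
    (lambda : R[i]) :
  let M := A *m invmx (B + C) + B *m invmx (C + A) + C *m invmx (A + B) in
  eigenvalue M lambda ->
  complex.Im lambda = 0 /\ 3 / 2 <= complex.Re lambda.
Proof.
move=> M /eigenvalueP[v vM v0].
have pX := posdefmxD _ _ _ _ B_posdef C_posdef.
have pY := posdefmxD _ _ _ _ C_posdef A_posdef.
have pZ := posdefmxD _ _ _ _ A_posdef B_posdef.
pose S := A + B + C; have pS : posdefmx S := posdefmxD _ _ _ _ pZ C_posdef.
(* Each numerator is [S] minus its denominator. *)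
have shift P Q : posdefmx Q -> P = S - Q -> P *m invmx Q = S *m invmx Q - 1%:M.
  by move=> /posdefmx_unit uQ ->; rewrite mulmxBl mulmxV.
have MS : M = S *m invmx (B + C) + S *m invmx (C + A) + S *m invmx (A + B)
              - 3%:R%:M.
  have -> : M = S *m invmx (B + C) - 1%:M + (S *m invmx (C + A) - 1%:M)
                + (S *m invmx (A + B) - 1%:M).
    congr (_ + _ + _); apply: shift => //.
    - by rewrite /S -[A + B + C]addrA addrK.
    - by rewrite /S [C + A]addrC [A + B + C]addrAC [RHS]addrC addKr.
    - by rewrite /S [RHS]addrC addKr.
  rewrite [X in X + _]addrACA -opprD addrACA -opprD -!raddfD /=.
  by congr (_ - _%:M); ring.
pose q P : R[i] := (v *m P *m v ^t*) 0 0.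
have qD P Q : q (P + Q) = q P + q Q by rewrite /q mulmxDr mulmxDl mxE.
have q_gt0 : 0 < q S by apply: posdefmx_row_gt0.
(* The sum of the three matrices is [M + 3] times [S], and [v] absorbs [M + 3] as the scalar
   [lambda + 3]. *)
have qM : q (S *m invmx (B + C) *m S) + q (S *m invmx (C + A) *m S)
    + q (S *m invmx (A + B) *m S) = (lambda + 3) * q S.
  rewrite -!qD -!mulmxDl.
  have -> : S *m invmx (B + C) + S *m invmx (C + A) + S *m invmx (A + B)
      = M + 3%:R%:M by rewrite MS subrK.
  by rewrite /q mulmxA [v *m (M + _)]mulmxDr vM mul_mx_scalar -scalerDl -!scalemxAl mxE.
have qXYZ : q (B + C) + q (C + A) + q (A + B) = q S *+ 2.
  by rewrite !qD; ring.
(* The choice of [t] comes from the equality case [A = B = C]: there [S = 3 A] and each denominator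
   is [2 A], so [S Q^-1 = 3/2] and all three tangent bounds are sharp. *)
have t_real : 3 / 2 \is @Num.real R[i] by rewrite rpred_div ?realn.
have tangent Q : posdefmx Q ->
    3 / 2 *+ 2 * q S - (3 / 2) ^+ 2 * q Q <= q (S *m invmx Q *m S).
  by move=> pQ; apply: posdefmx_inv_tangent => //; apply: posdefmx_herm.
(* The three bounds add up to [9 q S - (9/4) (2 q S) <= (lambda + 3) q S]. *)
have : 0 <= (lambda - 3 / 2) * q S.
  have := lerD (lerD (tangent _ pX) (tangent _ pY)) (tangent _ pZ).
  rewrite qM -subr_ge0; congr (0 <= _).
  transitivity ((lambda - 6) * q S
    + (3 / 2) ^+ 2 * (q (B + C) + q (C + A) + q (A + B))); first by field.
  by rewrite qXYZ; field.
rewrite pmulr_lge0 // subr_ge0.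
(* The order of [R[i]] compares only numbers with equal imaginary parts, so [3 / 2 <= lambda] yields
   both conclusions. *)
have -> : (3 / 2 : R[i]) = (3 / 2)%:C by rewrite fmorph_div !rmorph_nat.
by rewrite lecE /= => /andP[/eqP-> ->].
Qed.
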